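(* If a surjective dynamical system $(X,T)$ has the weak specification property, then it has the asymptotic average shadowing property.
   Context: A dynamical system $(X,T)$ is a compact metric space $X$ (metric $\rho$, diameter $1$ without loss of generality) with a continuous map $T\colon X\to X$; it is surjective if $T$ is onto. $\mathbb{N}$ denotes the positive integers. Weak specification. For integers $0\le a\le b$, the orbit segment of $x$ over $[a,b]$ is $T^{[a,b]}(x)=(T^a(x),T^{a+1}(x),\dots,T^b(x))$. For a function $N\colon\mathbb{N}\to\mathbb{N}$, a finite family of orbit segments $\{T^{[a_j,b_j]}(x_j)\}_{j=1}^n$ is an $N$-spaced specification if $a_i-b_{i-1}\ge N(b_i-a_i+1)$ for $2\le i\le n$. It is $\varepsilon$-traced by $y\in X$ if $\rho(T^k(y),T^k(x_i))\le\varepsilon$ for all $a_i\le k\le b_i$ and $1\le i\le n$. $(X,T)$ has the weak specification property if for every $\varepsilon>0$ there is a nondecreasing function $M_\varepsilon\colon\mathbb{N}\to\mathbb{N}$ with $M_\varepsilon(n)/n\to0$ as $n\to\infty$ such that every $M_\varepsilon$-spaced specification is $\varepsilon$-traced by some point of $X$. Asymptotic average shadowing. A sequence $\{x_n\}_{n=0}^\infty$ in $X$ is an asymptotic average pseudoorbit for $T$ if $\lim_{N\to\infty}\frac1N\sum_{n=0}^{N-1}\rho(T(x_n),x_{n+1})=0$. It is asymptotically shadowed in average by $x\in X$ if $\lim_{N\to\infty}\frac1N\sum_{n=0}^{N-1}\rho(T^n(x),x_n)=0$. $(X,T)$ has the asymptotic average shadowing property if every asymptotic average pseudoorbit of $T$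 is asymptotically shadowed in average by some point of $X$. *)

(* Defs.v *)
(* Libraries: MathComp and MathComp-Analysis. *)
From HB Require Import structures.
From mathcomp Require Import all_boot all_order all_algebra.
From mathcomp Require Import all_classical all_reals all_analysis.

Set Implicit Arguments.
Unset Strict Implicit.
Unset Printing Implicit Defensive.

Import Order.TTheory GRing.Theory Num.Theory.
Import numFieldNormedType.Exports.

Local Open Scope classical_set_scope.
Local Open Scope ring_scope.

(* T^[a,b](x), kept as the data (x, a, b) rather than as the tuple of points
   T^a x, ..., T^b x: spacing and tracing depend on a, b and x. *)
Record orbit_segment (X : Type) := OrbitSegment {
  seg_pt : X;
  seg_start : nat;
  seg_end : nat;
  seg_le : (seg_start <= seg_end)%N
}.

Definition seg_length (X : Type) (s : orbit_segment X) : nat :=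
  (seg_end s - seg_start s + 1)%N.

(* Functions from positive integers to positive integers are represented by
   functions [nat -> nat] whose value at 0 is never used.  The inequality
   a_i - b_(i-1) >= N (b_i - a_i + 1) is stated without truncated subtraction;
   here i is the predecessor of j. *)
Definition spaced_specification (X : Type) (N : nat -> nat) (n : nat)
    (s : 'I_n -> orbit_segment X) : Prop :=
  forall i j : 'I_n, j = i.+1 :> nat ->
    (seg_end (s i) + N (seg_length (s j)) <= seg_start (s j))%N.

Definition traced (R : realType) (X : metricType R) (T : X -> X) (e : R)
    (n : nat) (s : 'I_n -> orbit_segment X) (y : X) : Prop :=
  forall (i : 'I_n) (k : nat), (seg_start (s i) <= k <= seg_end (s i))%N ->
    mdist (iter k T y) (iter k T (seg_pt (s i))) <= e.

(* At n = 0 the quotient M n / n is 0 by convention, which does not affect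
   the limit; the same holds for the averages below. *)
Definition weak_specification (R : realType) (X : metricType R) (T : X -> X) :
    Prop :=
  forall e : R, 0 < e ->
    exists M : nat -> nat,
      [/\ forall n, (0 < n)%N -> (0 < M n)%N,
          forall m n, (0 < m)%N -> (m <= n)%N -> (M m <= M n)%N,
          (fun n : nat => (M n)%:R / n%:R : R) @ \oo --> (0 : R) &
          forall (n : nat) (s : 'I_n -> orbit_segment X), (0 < n)%N ->
            spaced_specification M s -> exists y : X, traced T e s y].

Definition asymptotic_average_pseudoorbit (R : realType) (X : metricType R)
    (T : X -> X) (x : nat -> X) : Prop :=
  (fun N : nat => N%:R^-1 * \sum_(0 <= n < N) mdist (T (x n)) (x n.+1) : R)
    @ \oo --> (0 : R).

Definition asymptotically_shadowed_in_average (R : realType)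
    (X : metricType R) (T : X -> X) (x : nat -> X) (y : X) : Prop :=
  (fun N : nat => N%:R^-1 * \sum_(0 <= n < N) mdist (iter n T y) (x n) : R)
    @ \oo --> (0 : R).

Definition asymptotic_average_shadowing (R : realType) (X : metricType R)
    (T : X -> X) : Prop :=
  forall x : nat -> X, asymptotic_average_pseudoorbit T x ->
    exists y : X, asymptotically_shadowed_in_average T x y.

(* Main.v *)
(* On a long but fixed time scale, uniform continuity makes an asymptotic average
   pseudoorbit close to genuine orbit segments, up to a constant times the
   accumulated defect.  Surjectivity lets such segments start at any prescribed
   time.  Weak specification glues them with gaps of small density, and since a
   gap depends only on the length of the segment after it, the gluing can be
   prefixed by an arbitrarily long orbit segment.  Iterating with precisions
   2^-k over rapidly growing blocks [t_k, t_(k+1)], where the point z_(k+1)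
   traces z_k on [0, t_k] and the pseudoorbit on the next block, gives a
   sequence any cluster point of which shadows in average. *)
Require Import Defs.
From HB Require Import structures.
From mathcomp Require Import all_boot all_order all_algebra.
From mathcomp Require Import all_classical all_reals all_analysis.
From mathcomp Require Import zify lra.

Set Implicit Arguments.
Unset Strict Implicit.

Import Order.TTheory GRing.Theory Num.Theory.
Import numFieldNormedType.Exports.

Local Open Scope classical_set_scope.
Local Open Scope ring_scope.

(** * Averages and sums over time windows *)

Lemma average_cvg0P (R : realType) (u : nat -> R) (u0 : forall n, 0 <= u n) :
  (fun n : nat => n%:R^-1 * u n) @ \oo --> (0 : R) <->
  forall e : R, 0 < e ->
    exists n0, forall n, (n0 <= n)%N -> (0 < n)%N -> u n <= e * n%:R.
Proof.
split=> [/cvgrPdist_le cu e e0|cu].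
  have [n0 _ n0P] := cu e e0; exists n0 => n n0n n_gt0.
  have := n0P n n0n; rewrite /= sub0r normrN ger0_norm ?mulr_ge0//.
  by rewrite ler_pdivrMl ?ltr0n// mulrC.
apply/cvgrPdist_le => e e0; have [n0 n0P] := cu e e0.
exists n0 => // n n0n; rewrite /= sub0r normrN ger0_norm ?mulr_ge0//.
case: n n0n => [|n] n0n; first by rewrite invr0 mul0r ltW.
by rewrite ler_pdivrMl ?ltr0n// mulrC n0P.
Qed.

Lemma ler_sum_nat_const (R : realType) (d : nat -> R) (c : R) (a b : nat) :
  (forall n, (a <= n < b)%N -> d n <= c) ->
  \sum_(a <= n < b) d n <= c * (b - a)%:R.
Proof.
move=> dc; rewrite mulr_natr -sumr_const_nat.
by rewrite big_nat [leRHS]big_nat; exact: ler_sum.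
Qed.

(** Models one window of the gluing: a gap of length [M] where only the diameter bound [D] is
    available, then a traced stretch of length [L] with error [c]. *)
Lemma ler_sum_gap (R : realType) (d : nat -> R) (D c : R) (s M L : nat) :
  (forall n, d n <= D) ->
  (forall i, (i < L)%N -> d (s + M + i)%N <= c) ->
  \sum_(s <= n < s + (M + L)) d n <= D * M%:R + c * L%:R.
Proof.
move=> dD dc; rewrite (@big_cat_nat _ _ _ (s + M))//=; [|lia..].
apply: lerD; first by rewrite -[X in D * X%:R](addKn s) ler_sum_nat_const.
rewrite [X in c * X%:R](_ : L = (s + (M + L) - (s + M))%N); last lia.
apply: ler_sum_nat_const => n nL.
by rewrite (_ : n = (s + M + (n - (s + M)))%N); [apply: dc; lia|lia].
Qed.

Lemma ler_sum_windows (R : realType) (d w : nat -> R) (a C : R) (t P m : nat) :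
  (forall j, (j < m)%N -> \sum_(t + j * P <= n < t + j * P + P) d n <=
     a + C * \sum_(t + j * P <= n < t + j * P + P) w n) ->
  \sum_(t <= n < t + m * P) d n <=
    a * m%:R + C * \sum_(t <= n < t + m * P) w n.
Proof.
elim: m => [|m IH] dw; first by rewrite mul0n addn0 !big_geq// !mulr0 addr0.
have mP : (t + m.+1 * P = t + m * P + P)%N by lia.
rewrite mP !(@big_cat_nat _ _ _ (t + m * P) t (t + m * P + P))//=; [|lia..].
have {}IH := IH (fun j jm => dw j (ltnW jm)).
have {}dw := dw m (ltnSn m).
by rewrite -natr1; lra.
Qed.

(** * Uniform estimates from compactness *)

Lemma compact_mdist_bounded (R : realType) (X : metricType R) :
  compact [set: X] -> exists2 D : R, 0 <= D & forall x y : X, mdist x y <= D.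
Proof.
move=> cX; have [[x0 _]|X0] := pselect ([set: X] !=set0); last first.
  by exists 0 => // x y; exfalso; apply: X0; exists x.
have /compact_near_coveringP cov := cX.
(* The bound [n] is a parameter tending to infinity: bounds valid near each point for all large [n]
   merge into a single one by compactness. *)
have [|n _ nP] := cov nat \oo (fun n x => mdist x0 x <= n%:R) _.
  move=> x _; exists (ball x 1, [set n | mdist x0 x + 1 < n%:R]) => /=.
    split; first exact: nbhsx_ballx.
    exact: nbhs_infty_gtr.
  move=> [y n] [/=]; rewrite ballEmdist /= => xy xn.
  by apply: le_trans (metric_triangle _ x _) _; lra.
exists (n%:R + n%:R); first by rewrite addr_ge0.
move=> x y; apply: le_trans (metric_triangle _ x0 _) _.
by rewrite lerD// ?(metric_sym x)//; exact: (nP n (leqnn n)).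
Qed.

(* A form of uniform continuity that stays linear in the distance, so that
   errors can be summed over time. *)
Lemma compact_linear_modulus (R : realType) (X : metricType R) (T : X -> X) :
  compact [set: X] -> continuous T -> forall e : R, 0 < e ->
  exists2 K : R, 0 <= K &
    forall u v : X, mdist (T u) (T v) <= e + K * mdist u v.
Proof.
move=> cX cT e e0; have [D D0 leD] := compact_mdist_bounded cX.
have /compact_near_coveringP cov := cX.
have [|n _ nP] := cov nat \oo
    (fun n u => forall v, mdist (T u) (T v) <= e + n%:R * mdist u v) _; last first.
  by exists n%:R => // u v; exact: (nP n (leqnn n)).
move=> x _.
have /cT : nbhs (T x) (ball (T x) (e / 2)) by apply: nbhsx_ballx; rewrite divr_gt0.
rewrite /nbhs/= => /nbhs_ballP[r /= r0 rP].
(* Either [v] is within [r / 2] of [u], so both lie in the [r]-ball of [x], or [n * mdist u v] alone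
   exceeds the diameter bound [D]. *)
exists (ball x (r / 2), [set n | D / (r / 2) < n%:R]) => /=.
  split; last exact: nbhs_infty_gtr.
  by apply: nbhsx_ballx; rewrite divr_gt0.
move=> [u n] [/= xu Dn] v.
have r20 : 0 < r / 2 by rewrite divr_gt0.
have [uv|uv] := ltP (mdist u v) (r / 2).
  have Txu : mdist (T x) (T u) < e / 2.
    have := rP u; rewrite /= !ballEmdist /=; apply.
    by move: xu; rewrite ballEmdist /=; lra.
  have Txv : mdist (T x) (T v) < e / 2.
    have := rP v; rewrite /= !ballEmdist /=; apply.
    by move: xu (metric_triangle x u v); rewrite ballEmdist /=; lra.
  have := metric_triangle (T u) (T x) (T v).
  rewrite (metric_sym (T u) (T x)) => Tuv.
  have : 0 <= n%:R * mdist u v by rewrite mulr_ge0// mdist_ge0.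
  by lra.
apply: (le_trans (leD _ _)); apply: ler_wpDl; first exact: ltW.
move: Dn; rewrite ltr_pdivrMr// => /ltW/le_trans; apply.
by rewrite ler_wpM2l.
Qed.

(** Each step multiplies the earlier error by the slope of a linear modulus and adds one defect.
    Since [C] depends only on [L] and [e], one constant serves every window. *)
Lemma iter_pseudoorbit_defect (R : realType) (X : metricType R) (T : X -> X) :
  compact [set: X] -> continuous T -> forall (L : nat) (e : R), 0 < e ->
  exists2 C : R, 0 <= C & forall (x : nat -> X) (a i : nat), (i <= L)%N ->
    mdist (iter i T (x a)) (x (a + i)%N) <=
      e + C * \sum_(a <= n < a + i) mdist (T (x n)) (x n.+1).
Proof.
move=> cX cT; elim=> [|L IH] e e0.
  exists 0 => // x a i; rewrite leqn0 => /eqP ->.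
  by rewrite /= addn0 mdistxx mul0r addr0 ltW.
have e20 : 0 < e / 2 by rewrite divr_gt0.
have [K K0 KP] := compact_linear_modulus cX cT e20.
have K10 : 0 < K + 1 by rewrite ltr_wpDl.
have [C1 C10 C1P] := IH _ e0.
(* This precision, amplified by [K], costs at most [e / 2]. In the final constant, [C1] handles
   [i <= L] and [K * C2 + 1] handles [i = L.+1]. *)
have [C2 C20 C2P] := IH _ (divr_gt0 e20 K10).
exists (C1 + (K * C2 + 1)); first by rewrite !addr_ge0// mulr_ge0.
move=> x a i iL; set S := \sum_(_ <= _ < _) _.
have S0 : 0 <= S by apply: sumr_ge0 => n _; exact: mdist_ge0.
have : 0 <= K * C2 * S by rewrite !mulr_ge0.
have : 0 <= C1 * S by rewrite !mulr_ge0.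
move: iL; rewrite leq_eqVlt => /orP[/eqP iL|iL]; last first.
  by move: (C1P x a i iL); rewrite -/S; lra.
rewrite iL in S S0 *.
have := C2P x a L (leqnn L); set S' := \sum_(_ <= _ < _) _ => C2L.
have SE : S = S' + mdist (T (x (a + L)%N)) (x (a + L).+1).
  by rewrite /S addnS big_nat_recr//= leq_addr.
move=> _ _; rewrite addnS /=.
apply: le_trans (metric_triangle _ (T (x (a + L)%N)) _) _.
apply: le_trans (lerD (KP _ _) (lexx _)) _.
have S'0 : 0 <= S' by apply: sumr_ge0 => n _; exact: mdist_ge0.
have d0 := mdist_ge0 (T (x (a + L)%N)) (x (a + L).+1).
have H1 : K * mdist (iter L T (x a)) (x (a + L)%N) <=
    K * (e / 2 / (K + 1) + C2 * S') by rewrite ler_wpM2l.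
have H2 : K * (e / 2 / (K + 1)) <= e / 2.
  by rewrite mulrCA ler_piMr ?(ltW e20)// ler_pdivrMr// mul1r; lra.
have H3 : 0 <= C1 * S by rewrite mulr_ge0.
have H4 : K * C2 * S' <= K * C2 * S by rewrite ler_wpM2l ?mulr_ge0//; lra.
lra.
Qed.

Lemma ler_sum_nat_sub (R : realType) (w : nat -> R) (a a' b' b : nat) :
  (forall n, 0 <= w n) -> (a <= a' <= b')%N -> (b' <= b)%N ->
  \sum_(a' <= n < b') w n <= \sum_(a <= n < b) w n.
Proof.
move=> w0 /andP[aa' ab'] b'b; have ab := leq_trans aa' (leq_trans ab' b'b).
rewrite [leRHS](big_cat_nat aa')/= ?(leq_trans ab')//.
rewrite [X in _ <= _ + X](big_cat_nat ab')//=.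
by rewrite ler_wpDl ?ler_wpDr// sumr_ge0.
Qed.

(** * Gluing by weak specification *)

Lemma iter_surj (X : Type) (T : X -> X) (n : nat) :
  set_surj [set: X] [set: X] T -> forall x, exists y, iter n T y = x.
Proof.
move=> sT; elim: n => [x|n IH x]; first by exists x.
have [y _ <-] := sT x I; have [w <-] := IH y.
by exists w; rewrite iterS.
Qed.

(* The spacing condition only involves the length of the later segment, so the
   initial segment of [z] may be arbitrarily long at no cost. *)
Lemma weak_specification_extension (R : realType) (X : metricType R)
    (T : X -> X) :
  compact [set: X] -> continuous T -> set_surj [set: X] [set: X] T ->
  weak_specification T -> forall eta : R, 0 < eta ->
  exists2 C : R, 0 <= C & forall (x : nat -> X) (z : X) (t t' : nat),
    exists z' : X,
      (forall n, (n <= t)%N -> mdist (iter n T z') (iter n T z) <= eta) /\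
      (forall N, (t <= N <= t')%N ->
        \sum_(t <= n < N) mdist (iter n T z') (x n) <=
          eta * (N - t)%:R +
          C * (1 + \sum_(t <= n < N) mdist (T (x n)) (x n.+1))).
Proof.
move=> cX cT sT wT eta eta0; have [D D0 leD] := compact_mdist_bounded cX.
have eta30 : 0 < eta / 3 by rewrite divr_gt0.
have D10 : 0 < D + 1 by rewrite ltr_wpDl.
have [M [_ _ M0 Mspec]] := wT _ eta30.
(* Sublinearity of [M] gives a length [L] whose gap [m = M L], even at full diameter error, costs at
   most [eta / 3] per traced time. *)
have [m [L [L0 DM mL]]] : exists m L : nat,
    [/\ (0 < L)%N, D * m%:R <= eta / 3 * L%:R & m = M L].
  have : (fun n : nat => n%:R^-1 * (M n)%:R : R) @ \oo --> (0 : R).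
    by under eq_fun do rewrite mulrC.
  move=> /average_cvg0P -/(_ (fun n => ler0n _ _) _ (divr_gt0 eta30 D10)) [n0 n0P].
  exists (M n0.+1), n0.+1; split => //.
  have := n0P n0.+1 (leqnSn _) isT; rewrite mulrAC ler_pdivlMr// mulrC.
  apply: le_trans; rewrite ler_wpM2r//; lra.
have [C1 C10 C1P] := iter_pseudoorbit_defect cX cT L eta30.
pose P := (m + L)%N.
(* [D * P] pays for the last, incomplete window; [L * C1] pays for the defects inside complete
   windows. *)
exists (D * P%:R + L%:R * C1); first by rewrite addr_ge0 ?mulr_ge0.
move=> x z t t'.
pose start j := (t + j * P + m)%N.
(* The orbit of [p n] is at [x n] at time [n], so segments can be placed at their true times. *)
have [p pP] := choice (fun n => iter_surj n sT (x n)).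
(* Segment 0 follows [z] on [[0, t]]. Segment [j.+1] fills the last [L] times of window [j], after a
   gap of [m]. Windows have length [P >= 1], so [t'] of them reach time [t']. *)
pose seg i := if i is j.+1
  then OrbitSegment (p (start j)) (leq_addr L.-1 (start j))
  else OrbitSegment z (leq0n t).
have segsp : spaced_specification M (fun i : 'I_t'.+1 => seg i).
  move=> i j ->; case: (nat_of_ord i) => [|k]; rewrite /seg_length /=.
    by rewrite (_ : (_ - _ + 1)%N = L) -?mL /start; lia.
  by rewrite (_ : (_ - _ + 1)%N = L) -?mL /start; lia.
have [y yP] := Mspec _ _ (ltn0Sn _) segsp.
have yz n : (n <= t)%N -> mdist (iter n T y) (iter n T z) <= eta / 3.
  by move=> nt; have := yP ord0 n; rewrite /= nt; apply.
have yx j i : (j < t')%N -> (i < L)%N ->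
    mdist (iter (start j + i) T y) (iter i T (x (start j))) <= eta / 3.
  move=> jt iL; have := yP (Ordinal (jt : (j.+1 < t'.+1)%N)) (start j + i)%N.
  have -> : iter i T (x (start j)) = iter (start j + i) T (p (start j)).
    by rewrite addnC iterD pP.
  apply.
  by rewrite leq_addr /=; lia.
exists y; split; first by move=> n /yz; lra.
pose d n := mdist (iter n T y) (x n).
pose w n := mdist (T (x n)) (x n.+1).
have w0 n : 0 <= w n by exact: mdist_ge0.
have sw0 a b : 0 <= \sum_(a <= n < b) w n by apply: sumr_ge0.
(* Three shares of [eta / 3]: the gap, the tracing, and the passage from orbit to pseudoorbit. *)
have window j : (j < t')%N -> \sum_(t + j * P <= n < t + j * P + P) d n <=
    eta * P%:R + (L%:R * C1) * \sum_(t + j * P <= n < t + j * P + P) w n.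
  move=> jt; set W := \sum_(_ <= _ < _) w _.
  have dW i : (i < L)%N -> d (t + j * P + m + i)%N <= eta / 3 + (eta / 3 + C1 * W).
    move=> iL; apply: le_trans (metric_triangle _ (iter i T (x (start j))) _) _.
    apply: lerD; first exact: yx.
    apply: le_trans (C1P x (start j) i (ltnW iL)) _.
    by rewrite lerD2l ler_wpM2l// ler_sum_nat_sub// /start /P; lia.
  have dD n : d n <= D by exact: leD.
  apply: le_trans (ler_sum_gap dD dW) _.
  have := mulr_ge0 (ltW eta0) (ler0n R m).
  rewrite /P natrD; lra.
move=> N /andP[tN Nt'].
have P0 : (0 < P)%N by rewrite /P; lia.
have NE := divn_eq (N - t) P; have rP := ltn_pmod (N - t) P0.
move: NE rP; set q := (_ %/ _)%N; set r := (_ %% _)%N => NE rP.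
have qt' : (q <= t')%N.
  by apply: leq_trans Nt'; have := leq_pmulr q P0; lia.
have full := ler_sum_windows (fun j jq => window j (leq_trans jq qt')).
have rest : \sum_(t + q * P <= n < N) d n <= D * P%:R.
  apply: le_trans (ler_sum_nat_const (fun n _ => leD _ _)) _.
  by rewrite ler_wpM2l// ler_nat; lia.
rewrite -[X in X <= _]/(\sum_(t <= n < N) d n).
rewrite -[X in _ + _ * (1 + X)]/(\sum_(t <= n < N) w n).
have tqN : (t + q * P <= N)%N by lia.
rewrite !(@big_cat_nat _ _ _ (t + q * P) t N)//=; [|lia..].
have := sw0 (t + q * P)%N N; have := sw0 t (t + q * P)%N.
move: full rest; set S1 := \sum_(t <= n < _) w n.
set S2 := \sum_(_ <= n < N) w n => full rest S10 S20.
have H1 : eta * P%:R * q%:R <= eta * (N - t)%:R.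
  by rewrite -mulrA -natrM ler_pM2l// ler_nat; lia.
have H2 : 0 <= L%:R * C1 * S2 by rewrite !mulr_ge0.
have H3 : 0 <= D * P%:R * (S1 + S2) by rewrite !mulr_ge0// addr_ge0.
have H4 : 0 <= L%:R * C1 by rewrite mulr_ge0.
lra.
Qed.

(** * Absorption of defects and passage to a cluster point *)

Lemma average_cvg0_affine (R : realType) (u : nat -> R) :
  (forall n, 0 <= u n) ->
  (fun n : nat => n%:R^-1 * u n) @ \oo --> (0 : R) ->
  forall C e : R, 0 <= C -> 0 < e ->
    exists n0, forall n, (n0 <= n)%N -> C * (1 + u n) <= e * n%:R.
Proof.
move=> u0 /(average_cvg0P u0) cu C e C0 e0.
(* Half of [e * n] absorbs the term in [u n], half the constant; [C + 1] keeps the divisor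
   positive. *)
have C10 : 0 < 2 * (C + 1) by lra.
have [n0 n0P] := cu _ (divr_gt0 e0 C10).
have [n1 _ n1P] := nbhs_infty_gtr (2 * (C + 1) / e).
exists (maxn n0 n1.+1) => n; rewrite geq_max => /andP[n0n n1n].
have := n1P n (ltnW n1n); rewrite /= ltr_pdivrMr// => en.
have := n0P n n0n (leq_ltn_trans (leq0n _) n1n).
rewrite mulrAC ler_pdivlMr// => un.
have un1 : (C + 1) * (1 + u n) <= e * n%:R by lra.
by have := u0 n; lra.
Qed.

Lemma continuous_iter (X : topologicalType) (T : X -> X) (n : nat) :
  continuous T -> continuous (iter n T).
Proof.
move=> cT; elim: n => [|n IH] x; first exact: cvg_id.
by apply: continuous_comp; [exact: IH|exact: cT].
Qed.

(** For fixed [k] and [n] the estimate is a closed condition satisfied by the whole tail of [z],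
    hence by any cluster point. *)
Lemma compact_cluster_orbits (R : realType) (X : metricType R) (T : X -> X)
    (z : nat -> X) (t : nat -> nat) (r : nat -> R) :
  compact [set: X] -> continuous T ->
  (forall k j n, (n <= t k)%N ->
     mdist (iter n T (z (k + j)%N)) (iter n T (z k)) <= r k) ->
  exists y : X, forall k n, (n <= t k)%N ->
    mdist (iter n T y) (iter n T (z k)) <= r k.
Proof.
move=> cX cT zr.
have [y [_ clus]] := cX (z @ \oo) _ filterT.
exists y => k n nt; apply/ler_addgt0Pl => e e0.
have near_y : nbhs y (iter n T @^-1` ball (iter n T y) e).
  by apply: (continuous_iter cT); exact: nbhsx_ballx.
have near_z : (z @ \oo) [set w | exists j, w = z (k + j)%N].
  by exists k => // i /= ki; exists (i - k)%N; rewrite subnKC.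
have [w [[j ->]]] := clus _ _ near_z near_y.
rewrite /= ballEmdist /= => /ltW yz.
apply: le_trans (metric_triangle _ (iter n T (z (k + j)%N)) _) _.
by rewrite lerD// zr.
Qed.

(** * Construction of the shadowing point *)

Theorem theorem18 (R : realType) (X : metricType R) (T : X -> X)
    (compactX : compact [set: X]) (contT : continuous T)
    (surjT : set_surj [set: X] [set: X] T)
    (wspecT : weak_specification T) :
  asymptotic_average_shadowing T.
Proof.
move=> x xpseudo; have [D D0 leD] := compact_mdist_bounded compactX.
pose w n := mdist (T (x n)) (x n.+1).
have w0 n : 0 <= w n by exact: mdist_ge0.
pose eta k : R := 2 ^- k.
have eta0 k : 0 < eta k by rewrite invr_gt0 exprn_gt0.
have etaS k : eta k = 2 * eta k.+1.
  by rewrite /eta exprS invfM mulrA divff ?mul1r.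
have ext := weak_specification_extension compactX contT surjT wspecT.
have /choice[C CP] : forall k, exists c : R, 0 <= c /\
    forall (z : X) (t t' : nat), exists z' : X,
      (forall n, (n <= t)%N -> mdist (iter n T z') (iter n T z) <= eta k) /\
      (forall N, (t <= N <= t')%N ->
        \sum_(t <= n < N) mdist (iter n T z') (x n) <=
          eta k * (N - t)%:R + c * (1 + \sum_(t <= n < N) w n)).
  by move=> k; have [c c0 cP] := ext _ (eta0 k); exists c; split => //; exact: cP.
have sw0 N : 0 <= \sum_(0 <= n < N) w n by apply: sumr_ge0.
have /choice[f fP] : forall k, exists n0, forall n, (n0 <= n)%N ->
    C k * (1 + \sum_(0 <= i < n) w i) <= eta k * n%:R.
  by move=> k; apply: average_cvg0_affine => //; case: (CP k).
(* [t] is so sparse that [0, t k] is negligible in [0, t k.+1] and that the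
   defects before any time [N >= t k] are absorbed by [eta k * N]. *)
pose t := fix t k := if k is k'.+1 then (f k + (2 ^ k' * t k').+1)%N else f 0%N.
have ft k : (f k <= t k)%N by case: k => //= k; rewrite leq_addr.
have t2 k : (2 ^ k * t k < t k.+1)%N by rewrite /= leq_addl.
have tS k : (t k < t k.+1)%N.
  by apply: leq_ltn_trans (t2 k); rewrite leq_pmull ?expn_gt0.
have tle k j : (t k <= t (k + j))%N.
  elim: j => [|j IH]; first by rewrite addn0.
  by rewrite addnS; apply: leq_trans IH (ltnW (tS _)).
have tid N : (N <= t N)%N by elim: N => // N IH; exact: leq_ltn_trans IH (tS N).
have /choice[Z ZP] (q : nat * X) := (CP q.1).2 q.2 (t q.1) (t q.1.+1).
pose z := fix z k := if k is k'.+1 then Z (k', z k') else x 0%N.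
have zS k := ZP (k, z k).
(* The right side is the geometric sum of [eta k], ..., [eta (k + j - 1)] in closed form, which lets
   the induction on [j] close. *)
have zz k j n : (n <= t k)%N ->
    mdist (iter n T (z (k + j)%N)) (iter n T (z k)) <=
      2 * eta k - 2 * eta (k + j)%N.
  move=> nt; elim: j => [|j IH]; first by rewrite addn0 mdistxx subrr.
  have := (zS (k + j)%N).1 n (leq_trans nt (tle k j)).
  have := metric_triangle (iter n T (z (k + j).+1)) (iter n T (z (k + j)%N))
            (iter n T (z k)).
  by rewrite addnS /= in IH *; have := etaS (k + j)%N; lra.
have [|y yz] := @compact_cluster_orbits R X T z t (fun k => 2 * eta k)
                  compactX contT.
  by move=> k j n nt; have := zz k j n nt; have := eta0 (k + j)%N; lra.
exists y; pose d n := mdist (iter n T y) (x n).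
have d0 n : 0 <= d n by exact: mdist_ge0.
pose S N := \sum_(0 <= n < N) d n.
(* One [eta k] each for: [y] against [z k.+1] (as [2 * eta k.+1 = eta k]), the linear tracing error,
   and the absorbed defects. *)
have block k N : (t k <= N <= t k.+1)%N -> S N <= S (t k) + 3 * eta k * N%:R.
  move=> tNt; have /andP[tN Nt] := tNt.
  rewrite /S (big_cat_nat (leq0n _) tN)/= lerD2l.
  pose d' n := mdist (iter n T (z k.+1)) (x n).
  have dd' n : (t k <= n < N)%N -> d n - d' n <= eta k.
    move=> /andP[_ nN]; have := yz k.+1 n (ltnW (leq_trans nN Nt)).
    have := metric_triangle (iter n T y) (iter n T (z k.+1)) (x n).
    by have := etaS k; rewrite /d /d'; lra.
  have := ler_sum_nat_const dd'; rewrite sumrB.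
  have := (zS k).2 N tNt; rewrite /= -/(z k.+1).
  have : C k * \sum_(t k <= n < N) w n <= C k * \sum_(0 <= n < N) w n.
    by rewrite ler_wpM2l ?(CP k).1// ler_sum_nat_sub// tN.
  have := fP k N (leq_trans (ft k) tN).
  have : eta k * (N - t k)%:R <= eta k * N%:R.
    by rewrite ler_pM2l// ler_nat leq_subr.
  by rewrite /d'; lra.
(* Before [t k] only the diameter bound is used; sparseness of [t] makes that part at most
   [D * eta k * t k.+1]. *)
have St k : S (t k.+1) <= (D + 3) * eta k * (t k.+1)%:R.
  have := block k (t k.+1); rewrite leqnn ltnW// => /(_ isT).
  have : S (t k) <= D * (t k)%:R.
    by rewrite -[X in _ * X%:R]subn0; apply: ler_sum_nat_const => n _; exact: leD.
  have : D * (t k)%:R <= D * (eta k * (t k.+1)%:R).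
    rewrite ler_wpM2l// ler_pdivlMl ?exprn_gt0//.
    by rewrite -natrX -natrM ler_nat ltnW.
  lra.
(* Just after [t k.+1] the past is not negligible, so the bound [St] at that endpoint, of precision
   [eta k], is carried into the next block. *)
have SN k N : (t k.+1 <= N <= t k.+2)%N -> S N <= (D + 6) * eta k * N%:R.
  move=> tNt; have := block _ _ tNt; have := St k.
  have : (D + 3) * eta k * (t k.+1)%:R <= (D + 3) * eta k * N%:R.
    rewrite ler_wpM2l ?mulr_ge0 ?(ltW (eta0 k)) ?addr_ge0// ler_nat.
    by case/andP: tNt.
  have : 0 <= eta k.+1 * N%:R by rewrite mulr_ge0// ltW.
  have : eta k * N%:R = 2 * eta k.+1 * N%:R by rewrite -etaS.
  lra.
apply/(average_cvg0P (u := S)) => [n|e e0]; first exact: sumr_ge0.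
have [K KP] : exists K, (D + 6) * eta K <= e.
  have [n _ nP] := nbhs_infty_gtr ((D + 6) / e).
  exists n; rewrite ler_pdivrMr ?exprn_gt0// mulrC.
  have := nP n (leqnn n); rewrite /= ltr_pdivrMr// => /ltW/le_trans; apply.
  by rewrite ler_pM2r// -natrX ler_nat ltnW// ltn_expl.
have etaK j : eta (K + j)%N <= eta K.
  elim: j => [|j IH]; first by rewrite addn0.
  by have := etaS (K + j)%N; have := eta0 (K + j).+1; rewrite addnS; lra.
exists (t K.+1) => N tN N0.
have [k [Kk tk]] : exists k, (K <= k)%N /\ (t k.+1 <= N <= t k.+2)%N.
  (* The least admissible [k] locates the block of [N]: either [k = K], where the lower bound is the
     assumption on [N], or minimality excludes [N <= t k.+1]. *)
  have ex : exists k, (K <= k)%N && (N <= t k.+2)%N.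
    exists (K + N)%N; rewrite leq_addr andTb; apply: leq_trans (tid N) _.
    by rewrite (_ : (K + N).+2 = N + K.+2)%N ?tle//; lia.
  case: (ex_minnP ex) => k /andP[Kk Nk] kmin; exists k; split=> //.
  rewrite Nk andbT; move: Kk; rewrite leq_eqVlt => /predU1P[<- //|].
  case: k Nk kmin => // k Nk kmin Kk; rewrite leqNgt; apply/negP => Nt.
  by have := kmin k; rewrite -ltnS Kk (ltnW Nt) ltnn => /(_ isT).
apply: le_trans (SN k N tk) _; rewrite ler_wpM2r//.
apply: le_trans KP; rewrite ler_wpM2l ?addr_ge0//.
by rewrite -(subnKC Kk).
Qed.
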